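(* Let $k,d,k',d'$ be positive integers with $k\geq 2d$ and $k'\geq 2d'$. If $\vartheta(\overline{K_{k/d}})=\vartheta(\overline{K_{k'/d'}})$, then $k/d=k'/d'$.
   Context: For integers $k\geq 2d\geq 2$, $K_{k/d}$ has vertex set $\{0,\dots,k-1\}$, with $i,j$ adjacent iff $d\leq|i-j|\leq k-d$; $\overline{K_{k/d}}$ is its complement. The Lov\'asz theta number of $G=(V,E)$ is $\vartheta(G)=\max\{\sum_{x,y}B(x,y): B\in\mathbb{R}^{V\times V}$ symmetric positive semidefinite, $\sum_x B(x,x)=1$, $B(x,y)=0$ for $xy\in E\}$. *)

(* Defs.v *)
From mathcomp Require Import all_boot all_order all_algebra.
From mathcomp Require Import boolp classical_sets functions reals topology.
From mathcomp Require Import normedtype derive ring lra.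

Set Implicit Arguments.
Unset Strict Implicit.
Unset Printing Implicit Defensive.

Import Order.TTheory GRing.Theory Num.Theory.
Import numFieldNormedType.Exports.

Local Open Scope classical_set_scope.
Local Open Scope ring_scope.

(* Graphs are given by their adjacency relation on the vertex set 'I_n. *)

Definition circular_complete (k d : nat) : rel 'I_k :=
  fun i j => (d <= `|i - j| <= k - d)%N.
Arguments circular_complete : clear implicits.

Definition complement (n : nat) (adj : rel 'I_n) : rel 'I_n :=
  fun x y => (x != y) && ~~ adj x y.

Definition psd (R : realType) (n : nat) (B : 'M[R]_n) : Prop :=
  B^T = B /\ forall u : 'cV[R]_n, 0 <= (u^T *m B *m u) ord0 ord0.

Definition theta_feasible (R : realType) (n : nat) (adj : rel 'I_n)
    (B : 'M[R]_n) : Prop :=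
  [/\ psd B, \sum_x B x x = 1 & forall x y, adj x y -> B x y = 0].

Definition theta_objective (R : realType) (n : nat) (B : 'M[R]_n) : R :=
  \sum_x \sum_y B x y.

(* The supremum is a maximum as soon as the graph has a vertex: see
   [lovasz_theta_max] below. *)
Definition lovasz_theta (R : realType) (n : nat) (adj : rel 'I_n) : R :=
  sup [set theta_objective B | B in [set B : 'M[R]_n | theta_feasible adj B]].

Lemma circular_complete_sym k d : symmetric (circular_complete k d).
Proof. by move=> i j; rewrite /circular_complete distnC. Qed.

Lemma circular_complete_irr k d : (0 < d)%N ->
  irreflexive (circular_complete k d).
Proof. by move=> d_gt0 i; rewrite /circular_complete distnn leqNgt d_gt0. Qed.

Lemma quad_formE (R : realType) (n : nat) (B : 'M[R]_n) (u : 'cV[R]_n) :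
  (u^T *m B *m u) ord0 ord0 = \sum_x \sum_y u x ord0 * B x y * u y ord0.
Proof.
rewrite mxE exchange_big; apply: eq_bigr => y _ /=.
by rewrite mxE mulr_suml; apply: eq_bigr => x _; rewrite mxE.
Qed.

Lemma psd_quad2 (R : realType) (n : nat) (B : 'M[R]_n) (x y : 'I_n) (s : R) :
  psd B -> 0 <= B x x + s * B x y *+ 2 + s ^+ 2 * B y y.
Proof.
move=> [symB posB].
have Byx : B y x = B x y by rewrite -[in LHS]symB mxE.
pose u : 'cV[R]_n := delta_mx x ord0 + s *: delta_mx y ord0.
have mxD_entry (M N : 'M[R]_1) : (M + N) ord0 ord0 = M ord0 ord0 + N ord0 ord0.
  by rewrite mxE.
have mxZ_entry a (M : 'M[R]_1) : (a *: M) ord0 ord0 = a * M ord0 ord0.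
  by rewrite mxE.
have uT : u^T = delta_mx ord0 x + s *: delta_mx ord0 y.
  by apply/matrixP => i j; rewrite !mxE !(andbC (j == _)).
have entry z w : (delta_mx ord0 z *m B *m delta_mx w ord0 : 'M_1) ord0 ord0 = B z w.
  by rewrite -rowE -colE !mxE.
have := posB u; rewrite uT /u !(mulmxDl, mulmxDr) -!(scalemxAl, scalemxAr).
rewrite !(mxD_entry, mxZ_entry) !entry Byx.
by congr (0 <= _); ring.
Qed.

Lemma theta_feasible_bounded (R : realType) (n : nat) (adj : rel 'I_n)
  (B : 'M[R]_n) : theta_feasible adj B -> forall x y, B x y \in `[-1, 1].
Proof.
move=> [psdB trB _] x y.
have diag_ge0 z : 0 <= B z z.
  by have := psd_quad2 z z 0 psdB; rewrite expr0n !mul0r mul0rn !addr0.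
have diag_le1 z : B z z <= 1.
  by rewrite -trB (bigD1 z) //= lerDl; apply: sumr_ge0.
have := psd_quad2 x y 1 psdB; have := psd_quad2 x y (-1) psdB.
have := diag_le1 x; have := diag_le1 y; rewrite in_itv /=; lra.
Qed.

Lemma theta_feasible_nonempty (R : realType) (n : nat) (adj : rel 'I_n) :
  (0 < n)%N -> irreflexive adj -> exists B : 'M[R]_n, theta_feasible adj B.
Proof.
move=> n_gt0 adj_irr; exists (n%:R^-1)%:M; split.
- split=> [|u]; first exact: tr_scalar_mx.
  rewrite -mulmxA mul_scalar_mx -scalemxAr mxE mulr_ge0 ?invr_ge0//.
  by rewrite mxE sumr_ge0 // => i _; rewrite mxE -expr2 sqr_ge0.
- under eq_bigr do rewrite mxE eqxx mulr1n.
  by rewrite sumr_const card_ord -[_ *+ n]mulr_natl divff // pnatr_eq0 -lt0n.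
- move=> x y; rewrite mxE; case: eqP => // <-; by rewrite adj_irr.
Qed.

Lemma continuous_entry (R : realType) (n : nat) (x y : 'I_n) :
  continuous (fun v : 'rV[R]_(n * n) => vec_mx v x y).
Proof.
rewrite (_ : (fun _ => _) = fun v : 'rV[R]_(n * n) => v ord0 (mxvec_index x y)).
  exact: coord_continuous.
by apply/funext => v; rewrite mxE.
Qed.

Lemma continuous_sum_entries (R : realType) (n : nat)
    (f : 'I_n -> 'rV[R]_(n * n) -> R) :
  (forall x, continuous (f x)) -> continuous (fun v => \sum_x f x v).
Proof.
move=> ctsf; apply: (@continuous_big R _ +%R 0 xpredT) => [|x _].
  exact: pseudometric_normed_Zmodule.add_continuous.
exact: ctsf.
Qed.

Lemma theta_feasible_compact (R : realType) (n : nat) (adj : rel 'I_n) :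
  compact [set v : 'rV[R]_(n * n) | theta_feasible adj (vec_mx v)].
Proof.
have box_compact : compact
    [set v : 'rV[R]_(n * n) | forall i, v ord0 i \in `[-1, 1]].
  exact: (@rV_compact R (n * n) (fun=> [set` `[-1, 1]])
    (fun=> @segment_compact R (-1) 1)).
apply: subclosed_compact box_compact _; last first.
  move=> v feas i; case/mxvec_indexP: i => x y.
  by have := theta_feasible_bounded feas x y; rewrite mxE.
pose C1 := \bigcap_(p in [set: 'I_n * 'I_n])
  [set v : 'rV[R]_(n * n) | vec_mx v p.2 p.1 - vec_mx v p.1 p.2 = 0].
pose C2 := \bigcap_(u in [set: 'cV[R]_n]) [set v : 'rV[R]_(n * n) |
  0 <= \sum_x \sum_y u x ord0 * vec_mx v x y * u y ord0].
pose C3 := [set v : 'rV[R]_(n * n) | \sum_x vec_mx v x x = 1].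
pose C4 := \bigcap_(p in [set p | adj p.1 p.2])
  [set v : 'rV[R]_(n * n) | vec_mx v p.1 p.2 = 0].
rewrite (_ : mkset _ = C1 `&` C2 `&` C3 `&` C4); last first.
  apply/seteqP; split=> v.
    move=> [[symv posv] trv adjv]; split; last by move=> p /adjv.
    split=> //; split=> [p _|u _] /=; last by rewrite -quad_formE.
    by rewrite -[in X in X - _]symv [in X in X - _]mxE subrr.
  move=> [[[v1 v2] v3] v4]; split=> //; last by move=> x y /(v4 (x, y)).
  split=> [|u]; last by rewrite quad_formE; exact: v2.
  by apply/matrixP => x y; rewrite mxE; apply/eqP; rewrite -subr_eq0;
    apply/eqP/(v1 (x, y)).
pose cf (f : 'rV[R]_(n * n) -> R) := continuous f.
have closed_pre f (D : set R) : cf f -> closed D -> closed (f @^-1` D).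
  by move=> ctsf; apply: preimage_closed => v _; exact: ctsf.
apply: closedI; first (apply: closedI; first apply: closedI).
- apply: closed_bigI => p _.
  apply: (closed_pre _ [set r | r = 0]); last exact: closed_eq.
  by move=> v; apply: continuousB; apply: continuous_entry.
- apply: closed_bigI => u _.
  apply: (closed_pre _ [set r | 0 <= r]); last exact: closed_ge.
  apply: continuous_sum_entries => x; apply: continuous_sum_entries => y.
  move=> v; apply: (@continuousM _ _ (fun w => u x ord0 * vec_mx w x y) (cst _));
    last exact: cst_continuous.
  apply: (@continuousM _ _ (cst _)); first exact: cst_continuous.
  exact: continuous_entry.
- apply: (closed_pre _ [set r | r = 1]); last exact: closed_eq.
  by apply: continuous_sum_entries => x; exact: continuous_entry.
- apply: closed_bigI => p _.
  apply: (closed_pre _ [set r | r = 0]); last exact: closed_eq.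
  exact: continuous_entry.
Qed.

Lemma lovasz_theta_max (R : realType) (n : nat) (adj : rel 'I_n) :
  (0 < n)%N -> irreflexive adj ->
  exists2 B : 'M[R]_n, theta_feasible adj B &
    theta_objective B = lovasz_theta R adj /\
    forall C : 'M[R]_n, theta_feasible adj C ->
      theta_objective C <= theta_objective B.
Proof.
move=> n_gt0 adj_irr; have [B0 feas0] := theta_feasible_nonempty R n_gt0 adj_irr.
pose A := [set v : 'rV[R]_(n * n) | theta_feasible adj (vec_mx v)].
have [||c cA cmax] := @EVT_max_rV _ _ (fun v => theta_objective (vec_mx v)) A _
    (@theta_feasible_compact R n adj).
- by exists (mxvec B0); rewrite /A /= mxvecK.
- apply: continuous_subspaceT; rewrite /theta_objective.
  apply: continuous_sum_entries => x; apply: continuous_sum_entries => y.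
  exact: continuous_entry.
have le_c C : theta_feasible adj C -> theta_objective C <= theta_objective (vec_mx c).
  move=> feasC; rewrite -[C]mxvecK; apply: cmax.
  by rewrite inE /A /= mxvecK.
have feasc : theta_feasible adj (vec_mx c) by move: cA; rewrite inE.
exists (vec_mx c) => //; split=> //; apply/eqP; rewrite eq_le; apply/andP; split.
  apply: ub_le_sup; last by exists (vec_mx c).
  by exists (theta_objective (vec_mx c)) => _ [C feasC <-]; exact: le_c.
apply: ge_sup; first by exists (theta_objective (vec_mx c)), (vec_mx c).
by move=> _ [C feasC <-]; exact: le_c.
Qed.

(* Main.v *)
Require Import Defs.
From mathcomp Require Import all_boot all_order all_algebra.
From mathcomp Require Import reals complex zify ring.

(* The homomorphisms between circular complete graphs make the theta number
   nondecreasing in k/d, so it suffices to find one strict increase between k/d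
   and k'/d'. Choose a large prime p and e with k/d <= p/(e+1) < p/e <= k'/d'.
   Let B be feasible for p/(e+1), averaged to a circulant matrix: its Fourier
   coefficients w_j are nonnegative, and sum_j w_j z^(jt) = 0 for 0 < |t| <= e,
   z a primitive p-th root of unity.

   If w had at most 2e nonzero coefficients, pairing it with the polynomial of
   degree 2e vanishing at the corresponding z^j (completed by a power of X - 1)
   would make the middle coefficient of that polynomial vanish. This coefficient
   is R(z) with R in Z[Y] and R(1) = +-C(2e, e), which is prime to p, whereas
   R(z) = 0 forces p | R(1): a contradiction.

   So the support of w minus 0 has at least 2e elements, and Lagrange
   interpolation yields q supported there and at 0, with q_0 = 1 and
   sum_j q_j z^(jt) = 0 for |t| < e. For small eps > 0 the matrix with Fourier
   coefficients w + eps q is feasible for p/e with a larger objective. *)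

Set Implicit Arguments.
Unset Strict Implicit.
Unset Printing Implicit Defensive.

Import Order.TTheory GRing.Theory Num.Theory.
Local Open Scope ring_scope.

(** * Shifted cyclotomic polynomials and primitive roots of unity *)

(* For p prime this is Phi_p(X + 1), an Eisenstein polynomial at p. *)
Definition shifted_cyclotomic (p : nat) : {poly int} :=
  \poly_(i < p) 'C(p, i.+1)%:R.

Lemma shifted_cyclotomicE p : shifted_cyclotomic p * 'X = ('X + 1) ^+ p - 1.
Proof.
rewrite [X in X ^+ p]addrC exprDn big_ord_recl /= expr1n mul1r expr0 bin0 mulr1n
  [RHS]addrAC subrr add0r.
rewrite /shifted_cyclotomic poly_def mulr_suml; apply: eq_bigr => i _.
by rewrite expr1n mul1r -scalerAl -exprSr scaler_nat.
Qed.

Lemma size_shifted_cyclotomic p : (0 < p)%N -> size (shifted_cyclotomic p) = p.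
Proof.
by move=> p_gt0; rewrite size_poly_eq // prednK // binn oner_eq0.
Qed.

Lemma monic_shifted_cyclotomic p :
  (0 < p)%N -> shifted_cyclotomic p \is monic.
Proof.
move=> p_gt0; rewrite monicE lead_coefE size_shifted_cyclotomic // coef_poly.
by rewrite prednK // leqnn binn.
Qed.

Lemma shifted_cyclotomic_irr p : prime p -> irreducible_poly (shifted_cyclotomic p).
Proof.
move=> p_pr; have p_gt0 := prime_gt0 p_pr; have p_gt1 := prime_gt1 p_pr.
apply: (eisenstein_crit p_pr); rewrite ?size_shifted_cyclotomic //.
- by rewrite neq_ltn p_gt1 orbT.
- rewrite (eqP (monic_shifted_cyclotomic p_gt0)) dvdz1.
  by rewrite neq_ltn p_gt1 orbT.
- rewrite coef_poly p_gt0 bin1 natz dvdzE !absz_nat gtnNdvd //.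
  by rewrite ltn_Pmull.
- move=> i ltip; rewrite coef_poly (leq_trans ltip (leq_pred _)) natz dvdzE
    !absz_nat.
  by apply: prime_dvd_bin => //=; rewrite -ltn_predRL.
Qed.

(** A root y of the shifted cyclotomic polynomial gives z = y + 1 with z^p = 1. Its constant
    coefficient is p, nonzero in [C], so y is nonzero and the order of z, a divisor of p other than
    1, is p. *)
Lemma prime_primitive_root_exists (C : closedFieldType) p :
  prime p -> p%:R != 0 :> C -> exists z : C, p.-primitive_root z.
Proof.
move=> p_pr pN0; have p_gt0 := prime_gt0 p_pr.
pose g := map_poly (intr : int -> C) (shifted_cyclotomic p).
have [y /rootP gy0] : exists y, root g y.
  apply/closed_rootP; rewrite size_map_poly_id0.
    by rewrite size_shifted_cyclotomic // neq_ltn prime_gt1 ?orbT.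
  by rewrite (eqP (monic_shifted_cyclotomic p_gt0)) rmorph1 oner_neq0.
have z1 : (y + 1) ^+ p = 1.
  have := congr1 (horner^~ y) (congr1 (map_poly (intr : int -> C))
    (shifted_cyclotomicE p)).
  rewrite rmorphM rmorphB rmorphXn rmorphD /= map_polyX rmorph1 !hornerE gy0 mul0r.
  by move/esym/subr0_eq.
have yN0 : y != 0.
  apply: contra_neq pN0 => y0; move: gy0;
    rewrite y0 horner_coef0 coef_map coef_poly p_gt0 /=.
  by rewrite bin1 natz.
have [m m_prim m_dvd] := prim_order_exists p_gt0 z1.
have mN1 : m != 1%N.
  apply: contraNneq yN0 => m1; have := prim_expr_order m_prim.
  by rewrite m1 expr1 -[X in _ = X]add0r => /addIr ->.
exists (y + 1); rewrite -(prime_nt_dvdP p_pr mN1 m_dvd).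
exact: m_prim.
Qed.

(** The irreducible [g] and the translate q(X + 1) share the root z - 1, so [g] divides q(X + 1). As
    [g] is monic, the quotient has integer coefficients; evaluating at 0, where [g] takes the value
    p, shows that p divides q(1). *)
Lemma dvdz_horner1_primitive_root (F : numFieldType) p (z : F) (q : {poly int}) :
  prime p -> p.-primitive_root z -> root (map_poly intr q) z -> (p %| q.[1])%Z.
Proof.
move=> p_pr z_prim qz0; have p_gt0 := prime_gt0 p_pr.
pose g := shifted_cyclotomic p; pose q1 := q \Po ('X + 1).
have gz : (map_poly intr g).[z - 1] = 0 :> F.
  have := congr1 (horner^~ (z - 1)) (congr1 (map_poly (intr : int -> F))
    (shifted_cyclotomicE p)).
  rewrite rmorphM rmorphB rmorphXn rmorphD /= map_polyX rmorph1 !hornerE subrK.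
  rewrite prim_expr_order // subrr => /eqP; rewrite mulf_eq0 subr_eq0.
  have zN1 : z != 1.
    by apply/eqP => z1; move: z_prim;
      rewrite z1 => /eq_prim_root_expr /(_ 1%N 0%N);
        rewrite !expr1n eqxx mod0n modn_small ?prime_gt1.
  by rewrite (negPf zN1) orbF => /eqP.
have q1z : (map_poly intr q1).[z - 1] = 0 :> F.
  rewrite map_comp_poly rmorphD /= map_polyX rmorph1 horner_comp !hornerE subrK.
  exact/rootP.
have /Pdiv.IdomainMonic.dvdpP : g %| q1.
  rewrite -[_ %| _]negbK -irreducible_poly_coprime;
    last exact: shifted_cyclotomic_irr.
  (* Over the integers a Bezout relation holds only up to nonzero factors a and b; evaluated at z -
     1 it reads 0 = b. *)
  apply/negP => /Bezout_coprimepP [[u v]] /=.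
  case/eqpP => -[a b] /= /andP[aN0 bN0]
    /(congr1 (fun r => (map_poly (intr : int -> F) r).[z - 1])).
  rewrite !linearZ !rmorphD !rmorphM /= rmorph1 !hornerE -/g gz q1z !mulr0 addr0
    mulr0 => /esym/eqP.
  by rewrite intr_eq0 (negPf bN0).
case=> [|u def_q1]; first exact: monic_shifted_cyclotomic.
have -> : q.[1] = q1.[0] by rewrite /q1 horner_comp !hornerE.
rewrite def_q1 hornerM !horner_coef0 coef_poly p_gt0 bin1 natz.
exact: dvdz_mull.
Qed.

(** * Nonvanishing of a middle coefficient *)

(** C(2d, d) divides (2d)!, a product of positive integers smaller than p. *)
Lemma prime_ndvd_central_bin p d : prime p -> (2 * d < p)%N ->
  ~~ (p %| 'C(2 * d, d))%N.
Proof.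
move=> p_pr lt_2dp.
apply: contraL lt_2dp => /(dvdn_mulr (d`! * (2 * d - d)`!)).
rewrite bin_fact ?leq_pmull // -leqNgt.
elim: (2 * d)%N => [|n IHn]; first by rewrite fact0 dvdn1; case: eqP p_pr => // ->.
by rewrite factS Euclid_dvdM // => /orP[/dvdn_leq-> // | /IHn/leqW].
Qed.

(* The coefficient is R(z) for some R in Z[Y] with R(1) = +-C(2d, d). *)
Lemma coef_prod_unity_roots_neq0 (F : numFieldType) p (z : F) d (S : {set 'I_p}) :
    prime p -> p.-primitive_root z -> (2 * d < p)%N -> (#|S| <= 2 * d)%N ->
  (\prod_(j in S) ('X - (z ^+ j)%:P) * ('X - 1) ^+ (2 * d - #|S|))`_d != 0.
Proof.
move=> p_pr z_prim lt_2dp leS.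
(* The product is lifted to a polynomial [Q] over Z[Y], with Y in place of z; [ev] substitutes z
   back. *)
pose ev : {poly int} -> F := horner_eval z \o map_poly intr.
pose Q : {poly {poly int}} :=
  \prod_(j in S) ('X - ('X^j)%:P) * ('X - 1) ^+ (2 * d - #|S|).
have evQ : map_poly ev Q =
    \prod_(j in S) ('X - (z ^+ j)%:P) * ('X - 1) ^+ (2 * d - #|S|).
  rewrite rmorphM rmorph_prod rmorphXn rmorphB /= map_polyX rmorph1; congr (_ * _).
  apply: eq_bigr => j _; rewrite rmorphB /= map_polyX map_polyC /= /ev /=.
  by rewrite map_polyXn /horner_eval hornerXn.
rewrite -evQ coef_map; apply/negP => /(dvdz_horner1_primitive_root p_pr z_prim).
(* At Y = 1 every factor of [Q] becomes X - 1, leaving the middle coefficient of (X - 1)^(2d). *)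
have -> : (Q`_d).[1] = (-1) ^+ d * 'C(2 * d, d)%:R.
  have -> : (Q`_d).[1] = (map_poly (horner_eval 1) Q)`_d by rewrite coef_map.
  rewrite rmorphM rmorph_prod rmorphXn rmorphB /= map_polyX rmorph1.
  rewrite (eq_bigr (fun=> 'X - 1)); last first.
    move=> j _; rewrite rmorphB /= map_polyX map_polyC /= /horner_eval hornerXn.
    by rewrite expr1n.
  have sgnC i : (-1) ^+ i = ((-1) ^+ i)%:P :> {poly int}.
    by rewrite polyC_exp polyCN polyC1.
  rewrite prodr_const -exprD subnKC // exprDn coef_sum.
  have ltd : (d < (2 * d).+1)%N by rewrite ltnS leq_pmull.
  rewrite (bigD1 (Ordinal ltd)) //= big1 ?addr0 => [|i neq_i].
    rewrite sgnC coefMn coefMC coefXn mul2n -addnn addnK eqxx mul1r.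
    by rewrite mulr_natr.
  rewrite sgnC coefMn coefMC coefXn.
  case: eqP => [def_d | _]; last by rewrite mul0r mul0rn.
  case/eqP: neq_i; apply: val_inj => /=; have := ltn_ord i; lia.
rewrite dvdzE abszM abszX abszN1 exp1n mul1n natz !absz_nat.
exact/negP/prime_ndvd_central_bin.
Qed.

(** * Lagrange interpolation and small perturbations *)

(** A polynomial of degree less than |T| is determined by its values at the nodes of [T]. The
    relation states that its value at [a i0] equals the interpolated one, so the coefficient at j in
    [T] is minus the Lagrange basis polynomial [l j] evaluated at [a i0]. *)
Lemma lagrange_relation (F : fieldType) (I : finType) (a : I -> F) (i0 : I)
    (T : {set I}) : injective a -> i0 \notin T ->
  exists r : I -> F, [/\ r i0 = 1, forall j, j != i0 -> j \notin T -> r j = 0 &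
    forall P : {poly F}, (size P <= #|T|)%N -> \sum_j r j * P.[a j] = 0].
Proof.
move=> a_inj i0T.
pose l (j : I) : {poly F} :=
  \prod_(i in T :\ j) ((a j - a i)^-1 *: ('X - (a i)%:P)).
have l_eq0 i j : i \in T -> i != j -> (l j).[a i] = 0.
  move=> iT neq_ij; rewrite horner_prod (bigD1 i) ?inE ?iT ?neq_ij //=.
  by rewrite !hornerE subrr mulr0 mul0r.
have l_eq1 j : (l j).[a j] = 1.
  rewrite horner_prod big1 // => i /setD1P[neq_ij _]; rewrite !hornerE mulVf //.
  by rewrite subr_eq0 (inj_eq a_inj) eq_sym.
have size_l j : j \in T -> (size (l j) <= #|T|)%N.
  move=> jT; rewrite (cardsD1 j) jT add1n.
  apply: (leq_trans (size_prod_leq _ _)) => /=.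
  rewrite leq_subLR; apply: (leq_ltn_trans (n := \sum_(i in T :\ j) 2)%N).
    apply: leq_sum => i _; apply: leq_trans (size_scale_leq _ _) _.
    by rewrite size_XsubC.
  by rewrite sum_nat_const muln2 -addnn addnS ltnS; apply: leqnn.
exists (fun j => if j == i0 then 1 else if j \in T then - (l j).[a i0] else 0).
split=> [|j /negPf-> /negPf-> //|P sizeP]; first by rewrite eqxx.
have interp : P = \sum_(j in T) P.[a j] *: l j.
  apply/eqP; rewrite -subr_eq0; apply/eqP.
  apply: (@roots_geq_poly_eq0 _ _ [seq a j | j <- enum T]).
  - apply/allP => x /mapP[i + ->]; rewrite mem_enum => iT.
    rewrite rootE !hornerE horner_sum (bigD1 i) //= big1 => [|j /andP[jT neq_ji]].
      by rewrite !hornerE l_eq1 mulr1 subrr.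
    by rewrite hornerE l_eq0 ?mulr0 // eq_sym.
  - by rewrite map_inj_uniq ?enum_uniq.
  - rewrite size_map -cardE; apply: (leq_trans (size_polyD _ _)).
    rewrite geq_max sizeP size_polyN; apply: (leq_trans (size_sum _ _ _)).
    by apply/bigmax_leqP => j jT;
      apply: leq_trans (size_scale_leq _ _) (size_l j jT).
rewrite (bigD1 i0) //= eqxx mul1r [in X in X + _]interp horner_sum.
rewrite [X in _ + X](eq_bigr (fun j => if j \in T then - (P.[a j] * (l j).[a i0])
  else 0)); last first.
  move=> j neq_j; rewrite (negPf neq_j).
  by case: ifP => _; rewrite ?mul0r // mulNr mulrC.
rewrite -big_mkcondr (eq_bigl [in T]) => [|j]; last first.
  by case: eqP => //= ->; rewrite (negPf i0T).
by rewrite sumrN -sumrB big1 // => j _; rewrite !hornerE subrr.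
Qed.

(** [M] bounds every |q_j| / w_j with w_j > 0, so eps = 1/M works there. Where w_j = 0 the quotient
    is 0 by convention, and the sign of q_j suffices. *)
Lemma small_perturbation_ge0 (R : realFieldType) (I : finType) (w q : I -> R) :
    (forall j, 0 <= w j) -> (forall j, w j = 0 -> 0 <= q j) ->
  exists2 eps, 0 < eps & forall j, 0 <= w j + eps * q j.
Proof.
move=> w_ge0 q_ge0; pose M := 1 + \sum_j `|q j| / w j.
have M_gt0 : 0 < M.
  by rewrite ltr_pwDl ?ltr01 // sumr_ge0 // => j _; rewrite divr_ge0.
exists M^-1 => [|j]; first by rewrite invr_gt0.
have [wj0 | wjN0] := eqVneq (w j) 0.
  by rewrite wj0 add0r mulr_ge0 ?q_ge0 // invr_ge0 ltW.
have wj_gt0 : 0 < w j by rewrite lt_def wjN0 w_ge0.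
rewrite -lerBlDr sub0r -mulrN mulrC ler_pdivrMr //.
have le_q : `|q j| / w j <= M.
  by rewrite /M (bigD1 j) //= addrCA lerDl addr_ge0 ?ler01 // sumr_ge0 // => i _;
    rewrite divr_ge0.
by rewrite (le_trans (ler_norm _)) // normrN mulrC -ler_pdivrMr.
Qed.

(** * Transport of feasible matrices along homomorphisms *)

Lemma theta_objectiveE (R : realType) n (B : 'M[R]_n) :
  theta_objective B =
    ((const_mx 1 : 'cV_n)^T *m B *m (const_mx 1 : 'cV_n)) ord0 ord0.
Proof.
by rewrite quad_formE; do 2!(apply: eq_bigr => ? _); rewrite !mxE mul1r mulr1.
Qed.

(** The new matrix sums [B] over pairs of fibres of [h], which preserves the total sum. The trace is
    also preserved, because distinct vertices of one fibre are related by [adj] and [B] vanishes on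
    them. *)
Lemma theta_feasible_pushforward (R : realType) n m (adj : rel 'I_n)
    (adj' : rel 'I_m) (h : 'I_n -> 'I_m) (B : 'M[R]_n) :
    (forall x y, x != y -> (h x == h y) || adj' (h x) (h y) -> adj x y) ->
    irreflexive adj' -> theta_feasible adj B ->
  exists2 B' : 'M[R]_m, theta_feasible adj' B' &
    theta_objective B' = theta_objective B.
Proof.
move=> h_hom irr' [[B_sym B_psd] B_tr B0].
pose H : 'M[R]_(n, m) := \matrix_(x, u) (h x == u)%:R.
have HH x y : (H *m H^T) x y = (h x == h y)%:R.
  rewrite mxE (bigD1 (h x)) //= !mxE eqxx mul1r big1 ?addr0 1?eq_sym //.
  by move=> u neq_u; rewrite !mxE eq_sym (negPf neq_u) mul0r.
have B0' x y : x != y -> (h x == h y) || adj' (h x) (h y) -> B x y = 0.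
  by move=> neq_xy hxy; apply: B0; apply: h_hom.
exists (H^T *m B *m H); first split.
- split=> [|u]; first by rewrite !trmx_mul trmxK B_sym mulmxA.
  by have := B_psd (H *m u); rewrite trmx_mul !mulmxA.
- change (\tr (H^T *m B *m H) = 1).
  rewrite mxtrace_mulC mulmxA mxtrace_mulC -B_tr; apply: eq_bigr => x _.
  rewrite mxE (bigD1 x) //= HH eqxx mulr1 big1 ?addr0 // => y neq_yx.
  rewrite HH; case: eqP => [hyx|_]; last by rewrite mulr0.
  by rewrite B0' ?mul0r // 1?eq_sym // hyx eqxx.
- move=> u v adj_uv; rewrite mxE big1 // => y _;
    rewrite mxE big_distrl big1 //= => x _.
  rewrite !mxE; case: eqP => [hx|_]; last by rewrite !mul0r.
  case: eqP => [hy|_]; last by rewrite mulr0.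
  have neq_xy : x != y.
    by apply: contraTneq adj_uv => eq_xy; rewrite -hx -hy eq_xy irr'.
  by rewrite B0' ?mulr0 ?mul0r // hx hy adj_uv orbT.
rewrite !theta_objectiveE.
have -> : (const_mx 1 : 'cV[R]_n) = H *m const_mx 1.
  apply/colP => x; rewrite !mxE (bigD1 (h x)) //= !mxE eqxx mul1r big1 ?addr0 //.
  by move=> u neq_u; rewrite !mxE eq_sym (negPf neq_u) mul0r.
by rewrite trmx_mul !mulmxA.
Qed.

Lemma complement_irr n (adj : rel 'I_n) : irreflexive (complement adj).
Proof. by move=> x; rewrite /complement eqxx. Qed.

Lemma circular_complete_hom k d k' d' :
    (0 < d)%N -> (0 < d')%N -> (k * d' <= k' * d)%N ->
  exists h : 'I_k -> 'I_k', forall x y,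
    circular_complete k d x y -> circular_complete k' d' (h x) (h y).
Proof.
move=> d_gt0 d'_gt0 le_kk'.
have lt_h (x : 'I_k) : (x * d' %/ d < k')%N.
  by rewrite ltn_divLR // (leq_trans _ le_kk') // ltn_pmul2r.
(* The map is x -> floor(x d' / d), a rescaling of the circle. *)
exists (fun x => Ordinal (lt_h x)) => x y.
wlog le_xy : x y / (x <= y)%N => [hwlog|].
  have [/hwlog // | /ltnW/hwlog adj_yx] := leqP x y.
  by rewrite circular_complete_sym => /adj_yx; rewrite circular_complete_sym.
rewrite /circular_complete /= (distnEr le_xy) => /andP[le_d le_kd].
(* Adding d' to floor(x d' / d) gives floor((x + d) d' / d), and x + d <= y. *)
have le_h : (x * d' %/ d + d' <= y * d' %/ d)%N.
  by rewrite addnC -divnMDl // leq_div2r // mulnC -mulnDl leq_pmul2r //; lia.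
(* Going once around: y + d <= x + k, and k d' <= k' d. *)
have le_h' : (y * d' %/ d + d' <= x * d' %/ d + k')%N.
  by rewrite addnC [leqRHS]addnC -!divnMDl // leq_div2r //; nia.
by rewrite distnEr; lia.
Qed.

Lemma theta_feasible_circular (R : realType) k d k' d' (B : 'M[R]_k) :
    (0 < d)%N -> (0 < d')%N -> (k * d' <= k' * d)%N ->
    theta_feasible (complement (circular_complete k d)) B ->
  exists2 B' : 'M[R]_k',
    theta_feasible (complement (circular_complete k' d')) B' &
    theta_objective B' = theta_objective B.
Proof.
move=> d_gt0 d'_gt0 le_kk';
  have [h h_hom] := circular_complete_hom d_gt0 d'_gt0 le_kk'.
apply: (theta_feasible_pushforward (h := h)); last exact: complement_irr.
move=> x y neq_xy; rewrite /complement neq_xy /=; apply: contraL => /h_hom adj'_xy.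
rewrite adj'_xy andbF orbF; apply: contraTneq adj'_xy => ->.
by rewrite circular_complete_irr.
Qed.

(** * Characters of Z/p and circulant matrices *)

Local Open Scope complex_scope.

Lemma mulJc_unity_root (R : rcfType) n (z : R[i]) :
  (0 < n)%N -> z ^+ n = 1 -> z * z^* = 1.
Proof.
move=> n_gt0 zn1; have := sqr_sqrtc (z * z^*); rewrite -normcE => <-.
have /eqP -> : `|z| == 1 by rewrite -(@pexpr_eq1 _ _ n) // -normrX zn1 normr1.
by rewrite expr1n.
Qed.

Lemma Re_sum (R : rcfType) (I : finType) (f : I -> R[i]) :
  complex.Re (\sum_i f i) = \sum_i complex.Re (f i).
Proof. by apply: (big_morph _ _ (erefl : complex.Re 0 = 0)) => -[? ?] [? ?]. Qed.

Lemma Im_sum (R : rcfType) (I : finType) (f : I -> R[i]) :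
  complex.Im (\sum_i f i) = \sum_i complex.Im (f i).
Proof. by apply: (big_morph _ _ (erefl : complex.Im 0 = 0)) => -[? ?] [? ?]. Qed.

Lemma ReM_real (R : rcfType) (c : R[i]) (t : R) :
  complex.Re (c * t%:C) = complex.Re c * t.
Proof. by case: c => a b /=; rewrite mulr0 subr0. Qed.

Section CirculantKernel.
Variables (R : realType) (p : nat) (z : R[i]).
Hypotheses (p_gt0 : (0 < p)%N) (z_prim : p.-primitive_root z).

Definition unity_char (j x : nat) : R[i] := z ^+ (j * x).

Local Notation chi := unity_char.

(** This is the real part of z^(j(x - y)), a cosine. The form as a sum of two products makes its
    quadratic form a sum of two squares. *)
Definition re_kernel (j x y : nat) : R :=
  complex.Re (chi j x) * complex.Re (chi j y) +
  complex.Im (chi j x) * complex.Im (chi j y).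

Lemma unity_charC j x : chi j x = chi x j.
Proof. by rewrite /chi mulnC. Qed.

Lemma unity_charD j x y : chi j (x + y) = chi j x * chi j y.
Proof. by rewrite /chi mulnDr exprD. Qed.

Lemma unity_char0 x : chi 0 x = 1. Proof. by []. Qed.

Lemma unity_charMJ j x : chi j x * (chi j x)^* = 1.
Proof.
by rewrite /chi rmorphXn -exprMn (mulJc_unity_root p_gt0) ?expr1n
  ?(prim_expr_order z_prim).
Qed.

(** Orthogonality of characters: a geometric sum whose ratio [a] is a p-th root of unity, equal to 1
    exactly when x and y agree mod p. *)
Lemma sum_chi x y : \sum_(j < p) chi j x * (chi j y)^* = p%:R *+ (x == y %[mod p]).
Proof.
pose a : R[i] := z ^+ x * (z ^+ y)^*.
have chi_a j : chi j x * (chi j y)^* = a ^+ j.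
  by rewrite /chi mulnC [(j * y)%N]mulnC !exprM exprMn rmorphXn.
have zyJ : (z ^+ y)^* * z ^+ y = 1.
  by rewrite mulrC; have := unity_charMJ 1 y; rewrite /chi mul1n.
have a1 : (a == 1) = (x == y %[mod p]).
  rewrite -(eq_prim_root_expr z_prim).
  apply/eqP/eqP => [a1 | eq_xy]; last first.
    by rewrite /a eq_xy mulrC zyJ.
  by rewrite -[LHS]mulr1 -zyJ mulrA -/a a1 mul1r.
rewrite (eq_bigr (fun j : 'I_p => a ^+ j)) // -a1; case: eqVneq => [->|aN1].
  rewrite (eq_bigr (fun=> 1)) => [|j _]; last by rewrite expr1n.
  by rewrite sumr_const card_ord.
have ap1 : a ^+ p = 1.
  rewrite /a exprMn -exprM mulnC exprM (prim_expr_order z_prim) expr1n mul1r.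
  by rewrite -rmorphXn -exprM mulnC exprM (prim_expr_order z_prim) expr1n rmorph1.
have /eqP := subrX1 a p.
by rewrite ap1 subrr eq_sym mulf_eq0 subr_eq0 (negPf aN1) => /eqP.
Qed.

Lemma re_kernelE j x y :
  (re_kernel j x y)%:C *+ 2 = chi j x * (chi j y)^* + chi j y * (chi j x)^*.
Proof.
rewrite /re_kernel; case: (chi j x) => a b; case: (chi j y) => c d.
by apply/eqP; rewrite eq_complex /=; apply/andP; split; apply/eqP; ring.
Qed.

Lemma re_kernel_sym j x y : re_kernel j x y = re_kernel j y x.
Proof. by rewrite /re_kernel !(mulrC (_ (chi j y))). Qed.

Lemma re_kernel_diag j x : re_kernel j x x = 1.
Proof.
apply: complexI; apply: (mulIf (x := 2)); first by rewrite pnatr_eq0.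
by rewrite mulr_natr re_kernelE unity_charMJ rmorph1 mul1r.
Qed.

Lemma re_kernel0 x y : re_kernel 0 x y = 1.
Proof. by rewrite /re_kernel /= mulr1 mulr0 addr0. Qed.

Lemma quad_re_kernel j n (u : 'I_n -> R) :
  \sum_(x < n) \sum_(y < n) u x * re_kernel j x y * u y =
  (\sum_(x < n) u x * complex.Re (chi j x)) ^+ 2 +
    (\sum_(x < n) u x * complex.Im (chi j x)) ^+ 2.
Proof.
rewrite !expr2 !mulr_suml -big_split; apply: eq_bigr => x _ /=.
rewrite !mulr_sumr -big_split; apply: eq_bigr => y _ /=.
by rewrite /re_kernel; ring.
Qed.

Lemma sum_re_kernel (j : 'I_p) :
  \sum_(x < p) \sum_(y < p) re_kernel j x y = (p ^ 2)%:R *+ (j == 0%N :> nat).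
Proof.
transitivity (\sum_(x < p) \sum_(y < p) 1 * re_kernel j x y * 1).
  by do 2!(apply: eq_bigr => ? _); rewrite mul1r mulr1.
rewrite (quad_re_kernel j (fun=> 1))
  (eq_bigr (fun x : 'I_p => complex.Re (chi j x))); last first.
  by move=> x _; rewrite mul1r.
rewrite [X in _ + X ^+ 2](eq_bigr (fun x : 'I_p => complex.Im (chi j x)));
  last first.
  by move=> x _; rewrite mul1r.
rewrite -Re_sum -Im_sum.
have -> : \sum_(x < p) chi j x = p%:R *+ (j == 0%N :> nat).
  have := sum_chi j 0; rewrite mod0n modn_small // => <-.
  by apply: eq_bigr => x _;
    rewrite unity_charC [chi x 0]unity_charC unity_char0 rmorph1 mulr1.
case: eqP => _; rewrite /= ?mulr0n ?expr0n ?addr0 //.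
rewrite mulr1n -(rmorph_nat (real_complex R)) /= expr0n addr0 natrX //.
Qed.

(** Adding both hypotheses gives twice the sum of the c_j against the kernel; the kernel being real,
    real parts can be taken termwise. *)
Lemma Re_sum_kernel (c : 'I_p -> R[i]) x y :
    \sum_j c j * (chi j x * (chi j y)^*) = 0 ->
    \sum_j c j * (chi j y * (chi j x)^*) = 0 ->
  \sum_j complex.Re (c j) * re_kernel j x y = 0.
Proof.
move=> cxy cyx.
have c_eq0 : \sum_j c j * (re_kernel j x y)%:C = 0.
  apply: (mulIf (x := 2)); first by rewrite pnatr_eq0.
  rewrite mul0r mulr_suml -[RHS]addr0 -[X in _ = X + _]cxy -[X in _ = _ + X]cyx
    -big_split.
  apply: eq_bigr => j _ /=.
  by rewrite -mulrA mulr_natr re_kernelE mulrDr.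
rewrite -[RHS](congr1 (@complex.Re R) c_eq0) Re_sum.
by apply: eq_bigr => j _; rewrite ReM_real.
Qed.

(** With the factor 1/p^2 the objective is the coefficient at 0, since only the trivial character
    has a nonzero sum, and the trace is the mean of the coefficients. *)
Definition circulant (c : 'I_p -> R) : 'M[R]_p :=
  \matrix_(x, y) ((p ^ 2)%:R^-1 * \sum_j c j * re_kernel j x y).

Lemma circulant_psd c : (forall j, 0 <= c j) -> psd (circulant c).
Proof.
move=> c_ge0; split=> [|u].
  by apply/matrixP => x y; rewrite !mxE; congr (_ * _); apply: eq_bigr => j _;
    rewrite re_kernel_sym.
rewrite quad_formE.
have -> : \sum_x \sum_y u x ord0 * circulant c x y * u y ord0 =
    (p ^ 2)%:R^-1 * \sum_j c j *
      \sum_(x < p) \sum_(y < p) u x ord0 * re_kernel j x y * u y ord0.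
  transitivity (\sum_(x < p) \sum_(y < p) \sum_j (p ^ 2)%:R^-1 *
    (c j * (u x ord0 * re_kernel j x y * u y ord0))).
    do 2!(apply: eq_bigr => ? _); rewrite mxE mulrAC mulrCA mulr_sumr mulr_sumr.
    by apply: eq_bigr => j _; ring.
  rewrite mulr_sumr; under eq_bigr do rewrite exchange_big.
  rewrite exchange_big; apply: eq_bigr => j _ /=.
  rewrite !mulr_sumr; apply: eq_bigr => x _; rewrite !mulr_sumr.
  by apply: eq_bigr => y _.
rewrite mulr_ge0 ?invr_ge0 ?ler0n // sumr_ge0 // => j _.
by rewrite mulr_ge0 // (quad_re_kernel j (fun x => u x ord0)) addr_ge0 ?sqr_ge0.
Qed.

Lemma circulant_trace c : \sum_x circulant c x x = p%:R^-1 * \sum_j c j.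
Proof.
have pN0 : p%:R != 0 :> R by rewrite pnatr_eq0 -lt0n.
rewrite (eq_bigr (fun=> (p ^ 2)%:R^-1 * \sum_j c j)) => [|x _].
  by rewrite sumr_const card_ord -[LHS]mulr_natl mulrA natrX; congr (_ * _); field.
rewrite mxE; congr (_ * _); apply: eq_bigr => j _.
by rewrite re_kernel_diag mulr1.
Qed.

Lemma circulant_objective (c : 'I_p -> R) (j0 : 'I_p) :
  j0 = 0%N :> nat -> theta_objective (circulant c) = c j0.
Proof.
move=> j00; have pN0 : p%:R != 0 :> R by rewrite pnatr_eq0 -lt0n.
transitivity ((p ^ 2)%:R^-1 *
    \sum_j c j * \sum_(x < p) \sum_(y < p) re_kernel j x y).
  rewrite /theta_objective mulr_sumr.
  under eq_bigr do under eq_bigr do rewrite mxE mulr_sumr.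
  under eq_bigr do rewrite exchange_big.
  rewrite exchange_big; apply: eq_bigr => j _ /=.
  by rewrite !mulr_sumr; apply: eq_bigr => x _; rewrite !mulr_sumr.
rewrite (bigD1 j0) //= [X in _ + X]big1 => [|j neq_j]; rewrite sum_re_kernel.
  by rewrite j00 eqxx addr0 mulrCA natrX mulr1n mulVf ?mulr1 // expf_neq0.
by rewrite -j00 (inj_eq val_inj) (negPf neq_j) mulr0.
Qed.

End CirculantKernel.

(** * Invariance of circular graphs under rotation *)

Lemma complement_circular_completeE p d (x y : 'I_p) :
  complement (circular_complete p d) x y =
  (x != y) && ((`|x - y| < d) || (p - d < `|x - y|))%N.
Proof.
by rewrite /complement /circular_complete negb_and -!ltnNge.
Qed.

(** The congruence says that a - b = y - x mod p, and the relation depends only on the cyclic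
    distance. *)
Lemma complement_circular_complete_shift p d (a b x y : 'I_p) :
    (2 * d <= p)%N -> a + x = b + y %[mod p] ->
    complement (circular_complete p d) x y ->
  complement (circular_complete p d) a b.
Proof.
rewrite !complement_circular_completeE -!val_eqE /= => le_2dp ax_by.
have := ltn_ord a; have := ltn_ord b; have := ltn_ord x; have := ltn_ord y.
move: (val a) (val b) (val x) (val y) ax_by => {}a {}b {}x {}y ax_by ltyp ltxp
  ltbp ltap.
have : [\/ (a + x = b + y)%N, (a + x = b + y + p)%N | (a + x + p = b + y)%N].
  have := divn_eq (a + x) p; have := divn_eq (b + y) p; rewrite ax_by.
  have : ((a + x) %/ p < 2)%N by rewrite ltn_divLR ?(leq_ltn_trans _ ltap) //; lia.
  have : ((b + y) %/ p < 2)%N by rewrite ltn_divLR ?(leq_ltn_trans _ ltap) //; lia.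
  move: (_ %/ p)%N (_ %/ p)%N => [|[|//]] [|[|//]] _ _ e1 e2;
  [apply: Or31|apply: Or33|apply: Or32|apply: Or31]; lia.
by case; lia.
Qed.

(** * Strict improvement from p/(d+1) to p/d *)

Section Improvement.
Variables (R : realType) (p d : nat) (z : R[i]) (B : 'M[R]_p).
Hypotheses (p_pr : prime p) (z_prim : p.-primitive_root z).
Hypotheses (d_gt0 : (0 < d)%N) (le_d_p : (2 * d.+1 <= p)%N).
Hypothesis B_feas : theta_feasible (complement (circular_complete p d.+1)) B.

Let p_gt0 := prime_gt0 p_pr.

(* Up to a factor, the Fourier coefficients of the circulant average of B. *)
Definition spectrum (j : 'I_p) : R := \sum_x \sum_y B x y * re_kernel z j x y.

Local Notation w := spectrum.
Local Notation chi := (unity_char z).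

(** [w j] is the sum of the values of the quadratic form of [B] at the real and at the imaginary
    part of the j-th character. *)
Lemma spectrum_ge0 j : 0 <= w j.
Proof.
have [[_ B_psd] _ _] := B_feas.
have quad_ge0 (f : 'I_p -> R) : 0 <= \sum_x \sum_y B x y * (f x * f y).
  have := B_psd (\col_x f x); rewrite quad_formE; congr (0 <= _).
  by do 2!(apply: eq_bigr => ? _); rewrite !mxE; ring.
have := addr_ge0 (quad_ge0 (fun x => complex.Re (chi j x)))
  (quad_ge0 (fun x => complex.Im (chi j x))).
rewrite -big_split; congr (0 <= _); apply: eq_bigr => x _.
by rewrite -big_split; apply: eq_bigr => y _ /=; rewrite /re_kernel mulrDr.
Qed.

Lemma spectrumE j : (w j)%:C = \sum_x \sum_y (B x y)%:C * (chi j x * (chi j y)^*).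
Proof.
have [[B_sym _] _ _] := B_feas.
have Byx x y : B y x = B x y by rewrite -[in LHS]B_sym mxE.
apply: (mulIf (x := 2)); first by rewrite pnatr_eq0.
transitivity (\sum_x \sum_y (B x y)%:C * ((re_kernel z j x y)%:C *+ 2)).
  rewrite rmorph_sum mulr_suml; apply: eq_bigr => x _.
  rewrite rmorph_sum mulr_suml; apply: eq_bigr => y _.
  by rewrite rmorphM -mulrA mulr_natr.
rewrite mulr_natr mulr2n [X in _ = _ + X]exchange_big -big_split;
  apply: eq_bigr => x _ /=.
rewrite -big_split; apply: eq_bigr => y _ /=.
by rewrite re_kernelE mulrDr Byx.
Qed.

(** By orthogonality, only the entries of [B] on the cyclic diagonal a - b = y - x mod p survive. *)
Lemma spectrum_fourier x y :
  \sum_j (w j)%:C * (chi j x * (chi j y)^*) =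
  p%:R * \sum_(a < p) \sum_(b < p) (B a b)%:C *+ (a + x == b + y %[mod p])%N.
Proof.
under eq_bigr do rewrite spectrumE mulr_suml.
rewrite exchange_big mulr_sumr; apply: eq_bigr => a _ /=.
under eq_bigr do rewrite mulr_suml.
rewrite exchange_big mulr_sumr; apply: eq_bigr => b _ /=.
rewrite mulrnAr mulrC -mulrnAr -(sum_chi p_gt0 z_prim) mulr_sumr.
by apply: eq_bigr => j _; rewrite !unity_charD rmorphM /= -!mulrA; congr (_ * _);
  ring.
Qed.

Lemma spectrum_fourier_eq0 (x y : 'I_p) :
  complement (circular_complete p d.+1) x y ->
  \sum_j (w j)%:C * (chi j x * (chi j y)^*) = 0.
Proof.
have [_ _ B0] := B_feas.
move=> xy; rewrite spectrum_fourier big1 ?mulr0 // => a _; rewrite big1 // => b _.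
case: eqP => // ab; rewrite B0 ?mul0rn //.
exact: complement_circular_complete_shift ab xy.
Qed.

Lemma sum_spectrum : \sum_j w j = p%:R.
Proof.
have [_ B_tr _] := B_feas.
apply: complexI; rewrite rmorph_nat.
transitivity (\sum_j (w j)%:C * (chi j 0 * (chi j 0)^*)).
  by rewrite rmorph_sum; apply: eq_bigr => j _;
    rewrite (unity_charMJ p_gt0 z_prim) mulr1.
rewrite spectrum_fourier -[RHS]mulr1 -[X in _ = _ * X](rmorph1 (real_complex R))
  -B_tr rmorph_sum.
congr (_ * _); apply: eq_bigr => a _;
  rewrite (bigD1 a) //= eqxx mulr1n big1 ?addr0 // => b.
by rewrite !addn0 !modn_small // (inj_eq val_inj) eq_sym => /negPf->.
Qed.

Lemma spectrum_support_gt : (2 * d < #|[set j | w j != 0%R]|)%N.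
Proof.
rewrite ltnNge; apply/negP => leS; set S := [set j | w j != 0] in leS.
have lt_2dp : (2 * d < p)%N by lia.
have lt_dp : (d < p)%N by lia.
have lt_d : (d < (2 * d).+1)%N by lia.
have powE (j i : nat) : (z ^+ j) ^+ i = chi j i by rewrite /unity_char exprM.
have := coef_prod_unity_roots_neq0 p_pr z_prim lt_2dp leS.
set Q := _ * _ => /eqP; case.
have sizeQ : (size Q <= (2 * d).+1)%N.
  apply: (leq_trans (size_polyMleq _ _)).
  rewrite -big_enum size_prod_XsubC -cardE -polyC1 size_exp_XsubC addSn /=.
  by rewrite addnS subnKC.
have Q_root j : (w j)%:C * Q.[z ^+ j] = 0.
  have [-> | wjN0] := eqVneq (w j) 0; first by rewrite mul0r.
  have jS : j \in S by rewrite inE.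
  by rewrite hornerM horner_prod (bigD1 j) //= hornerXsubC subrr !mul0r mulr0.
(* The conjugate character centres the exponents: i - d runs from -d to d, so every term with i
   distinct from d is a vanishing Fourier sum of [w]. *)
have : \sum_(j < p) (w j)%:C * (Q.[z ^+ j] * (chi j d)^*) = Q`_d * p%:R.
  under eq_bigr do rewrite (horner_coef_wide _ sizeQ) mulr_suml mulr_sumr.
  rewrite exchange_big /= (bigD1 (Ordinal lt_d)) //=.
  rewrite [X in _ + X]big1 ?addr0 => [|i neq_i].
    rewrite -(rmorph_nat (real_complex R)) -sum_spectrum rmorph_sum mulr_sumr;
      apply: eq_bigr => j _.
    by rewrite powE -mulrA (unity_charMJ p_gt0 z_prim) mulr1 mulrC.
  have lt_ip : (i < p)%N by have := ltn_ord i; lia.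
  have w_id0 : \sum_j (w j)%:C * (chi j i * (chi j d)^*) = 0.
    apply: (@spectrum_fourier_eq0 (Ordinal lt_ip) (Ordinal lt_dp)).
    rewrite complement_circular_completeE -val_eqE /= neq_i.
    by have := ltn_ord i; lia.
  transitivity (Q`_i * \sum_j (w j)%:C * (chi j i * (chi j d)^*)); last first.
    by rewrite w_id0 mulr0.
  by rewrite mulr_sumr; apply: eq_bigr => j _; rewrite powE; ring.
rewrite big1 => [/esym/eqP|j _]; last by rewrite mulrA Q_root mul0r.
by rewrite mulf_eq0 pnatr_eq0 gtn_eqF // orbF => /eqP.
Qed.

Lemma improving_direction :
  exists q : 'I_p -> R, [/\ forall j : 'I_p, j = 0%N :> nat -> q j = 1,
    forall j, w j = 0 -> 0 <= q j, \sum_j q j = 0 &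
    forall x y, complement (circular_complete p d) x y ->
      \sum_j q j * re_kernel z j x y = 0].
Proof.
pose j0 := Ordinal p_gt0; set S := [set j | w j != 0].
have a_inj : injective (fun j : 'I_p => z ^+ j).
  move=> i j /eqP; rewrite (eq_prim_root_expr z_prim) !modn_small //.
  by move=> /eqP; apply: val_inj.
have [|r [r_j0 r_out r_poly]] := lagrange_relation (i0 := j0) (T := S :\ j0) a_inj.
  by rewrite !inE eqxx.
(* [r] annihilates the powers 0 to 2d - 1; the twist by z^(j(d - 1)) moves the exponents -(d - 1) to
   d - 1 into that range. *)
pose c (j : 'I_p) := r j * z ^+ (j * d.-1).
have leS : (2 * d <= #|S :\ j0|)%N.
  have := spectrum_support_gt; rewrite -/S (cardsD1 j0); case: (_ \in _); lia.
have c_near x y : (x < p)%N -> (y < p)%N ->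
    (`|x - y| < d)%N || (p - d < `|x - y|)%N ->
    \sum_j c j * (chi j x * (chi j y)^*) = 0.
  move=> lt_xp lt_yp near_xy; pose m := ((d.-1 + x + (p - y)) %% p)%N.
  have lt_m : (m < 2 * d)%N.
    rewrite /m; have [le_yx | /ltnW le_xy] := leqP y x; last first.
      move: near_xy; rewrite (distnEr le_xy).
      case: (ltnP (y - x) d) => [lt_d _ | le_d /= near_xy].
        have [lt_yx|ge_yx] := ltnP (d.-1 + x) y; first by lia.
        have -> : (d.-1 + x + (p - y) = (d.-1 + x - y) + p)%N by lia.
        by rewrite modnDr modn_small; lia.
      by rewrite modn_small; lia.
    move: near_xy; rewrite (distnEl le_yx).
    case: (ltnP (x - y) d) => [lt_d _ | le_d /= near_xy].
      have -> : (d.-1 + x + (p - y) = (d.-1 + (x - y)) + p)%N by lia.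
      by rewrite modnDr modn_small; lia.
    have -> : (d.-1 + x + (p - y) = (d.-1 + (x - y) - p) + p + p)%N by lia.
    by rewrite !modnDr modn_small; lia.
  rewrite -[RHS](r_poly 'X^m); last by rewrite size_polyXn; lia.
  apply: eq_bigr => j _; rewrite /c hornerXn -mulrA; congr (_ * _).
  have chiJ : (chi j y)^* = chi j (p - y).
    apply: (mulfI (x := chi j y)).
      by apply: contra_eq_neq (unity_charMJ p_gt0 z_prim j y) => ->;
        rewrite mul0r eq_sym oner_eq0.
    rewrite (unity_charMJ p_gt0 z_prim) -unity_charD subnKC ?(ltnW lt_yp) //.
    by rewrite /unity_char mulnC exprM (prim_expr_order z_prim) expr1n.
  rewrite [X in _ * (_ * X)]chiJ -[z ^+ (j * _)]/(chi j d.-1) -!unity_charD addnA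
    -exprM.
  by apply/eqP; rewrite (eq_prim_root_expr z_prim) modnMmr.
have q_near x y : (x < p)%N -> (y < p)%N ->
    (`|x - y| < d)%N || (p - d < `|x - y|)%N ->
    \sum_j complex.Re (c j) * re_kernel z j x y = 0.
  move=> lt_xp lt_yp near_xy; apply: Re_sum_kernel; apply: c_near => //.
  by rewrite distnC.
exists (fun j => complex.Re (c j)); split.
- by move=> j j_0; have -> : j = j0; [exact: val_inj | rewrite /c r_j0 mul0n mulr1].
- move=> j wj0; have [-> | neq_j] := eqVneq j j0;
    first by rewrite /c r_j0 mul0n mulr1 ler01.
  by rewrite /c r_out ?mul0r // !inE wj0 eqxx andbF.
- rewrite -[RHS](q_near 0 0)%N ?distnn ?d_gt0 //; apply: eq_bigr => j _.
  by rewrite (re_kernel_diag p_gt0 z_prim) mulr1.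
- by move=> x y; rewrite complement_circular_completeE => /andP[_]; apply: q_near.
Qed.

Lemma theta_feasible_improve :
  exists2 B' : 'M[R]_p, theta_feasible (complement (circular_complete p d)) B' &
    theta_objective B < theta_objective B'.
Proof.
have [q [q0 q_ge0 sum_q q_near]] := improving_direction.
have [eps eps_gt0 c_ge0] := small_perturbation_ge0 spectrum_ge0 q_ge0.
exists (circulant z (fun j => w j + eps * q j)); last first.
  rewrite (circulant_objective p_gt0 z_prim _
    (erefl : Ordinal p_gt0 = 0%N :> nat)) q0 // mulr1.
  suff -> : theta_objective B = w (Ordinal p_gt0) by rewrite ltrDl.
  by do 2!(apply: eq_bigr => ? _); rewrite re_kernel0 mulr1.
split.
- exact: circulant_psd.
- rewrite circulant_trace // big_split /= -mulr_sumr sum_q mulr0 addr0 sum_spectrum.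
  by rewrite mulVf // pnatr_eq0 -lt0n.
move=> x y near_xy; rewrite mxE.
have near_xy' : complement (circular_complete p d.+1) x y.
  move: near_xy; rewrite !complement_circular_completeE => /andP[-> /=]; lia.
have near_yx' : complement (circular_complete p d.+1) y x.
  by move: near_xy'; rewrite !complement_circular_completeE eq_sym distnC.
have w_near : \sum_j w j * re_kernel z j x y = 0.
  by apply: (@Re_sum_kernel _ _ _ (fun j => (w j)%:C)); apply: spectrum_fourier_eq0.
under eq_bigr do rewrite mulrDl -mulrA.
by rewrite big_split /= -mulr_sumr w_near q_near // mulr0 addr0 mulr0.
Qed.

End Improvement.

Lemma lovasz_theta_lt (R : realType) k d k' d' :
    (0 < k)%N -> (0 < d)%N -> (0 < k')%N -> (0 < d')%N -> (2 * d <= k)%N ->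
    (k * d' < k' * d)%N ->
  lovasz_theta R (complement (circular_complete k d)) <
  lovasz_theta R (complement (circular_complete k' d')).
Proof.
move=> k_gt0 d_gt0 k'_gt0 d'_gt0 le_2d_k lt_kk'.
have [p lt_p p_pr] := prime_above (2 * k * k').
have p_gt0 := prime_gt0 p_pr.
have e_ge := leq_trunc_div (p * d) k.
have e_lt : (p * d < (p * d %/ k).+1 * k)%N by exact: ltn_ceil.
case def_e: (p * d %/ k)%N e_ge e_lt => [|e] e_ge e_lt; first by nia.
have le_hi : (p * d' <= k' * e)%N.
  by rewrite -(leq_pmul2r k_gt0); nia.
have e_gt0 : (0 < e)%N by nia.
have le_2e_p : (2 * e.+1 <= p)%N by rewrite -(leq_pmul2r d_gt0); nia.
have [z z_prim] : exists z : R[i], p.-primitive_root z.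
  by apply: prime_primitive_root_exists; rewrite // pnatr_eq0 -lt0n.
have [B B_feas [<- _]] := lovasz_theta_max R k_gt0
  (@complement_irr _ (circular_complete k d)).
have le_lo : (k * e.+1 <= p * d)%N by rewrite mulnC.
have [B1 B1_feas <-] := theta_feasible_circular d_gt0 (ltn0Sn e) le_lo B_feas.
have [B2 B2_feas lt12] := theta_feasible_improve p_pr z_prim e_gt0 le_2e_p B1_feas.
have [B3 B3_feas eq23] := theta_feasible_circular e_gt0 d'_gt0 le_hi B2_feas.
have [B' _ [<- B'_max]] :=
  lovasz_theta_max R k'_gt0 (@complement_irr _ (circular_complete k' d')).
by apply: lt_le_trans lt12 _; rewrite -eq23; apply: B'_max.
Qed.

Theorem mainTheorem11 (R : realType) (k d k' d' : nat)
    (k_gt0 : (0 < k)%N) (d_gt0 : (0 < d)%N)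
    (k'_gt0 : (0 < k')%N) (d'_gt0 : (0 < d')%N)
    (le_2d_k : (2 * d <= k)%N) (le_2d'_k' : (2 * d' <= k')%N)
    (eq_theta :
       lovasz_theta R (complement (circular_complete k d)) =
       lovasz_theta R (complement (circular_complete k' d'))) :
  k%:R / d%:R = k'%:R / d'%:R :> rat.
Proof.
have [lt_kk' | gt_kk' | eq_kk'] := ltngtP (k * d')%N (k' * d)%N.
- by have := lovasz_theta_lt R k_gt0 d_gt0 k'_gt0 d'_gt0 le_2d_k lt_kk';
    rewrite eq_theta ltxx.
- by have := lovasz_theta_lt R k'_gt0 d'_gt0 k_gt0 d_gt0 le_2d'_k' gt_kk';
    rewrite eq_theta ltxx.
by apply/eqP; rewrite eqr_div ?pnatr_eq0 -?lt0n // -!natrM eq_kk'.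
Qed.
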